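(* Let $T:V\to\mathfrak{g}$ be an $\mathcal{O}$-operator on a hom-Lie algebra $(\mathfrak{g},[\cdot,\cdot],\alpha)$ with respect to a representation $(V,\beta,\rho)$. Then $(V,\cdot_T,\beta)$ is a hom-pre-Lie algebra, where $v\cdot_T w=\{Tv,w\}$ for all $v,w\in V$.
   Context: The base field $k$ has characteristic zero. A (multiplicative) hom-Lie algebra $(\mathfrak{g},[\cdot,\cdot],\alpha)$ is a vector space $\mathfrak{g}$ with a skew-symmetric bilinear bracket and a linear map $\alpha:\mathfrak{g}\to\mathfrak{g}$ with $\alpha[x,y]=[\alpha(x),\alpha(y)]$ and $[\alpha(x),[y,z]]+[\alpha(y),[z,x]]+[\alpha(z),[x,y]]=0$ for all $x,y,z$. A representation $(V,\beta,\rho)$ is a vector space $V$, $\beta\in\mathrm{End}(V)$ and a linear map $\rho:\mathfrak{g}\to\mathrm{End}(V)$ with $\rho(\alpha(x))(\beta(v))=\beta(\rho(x)(v))$ and $\rho([x,y])(\beta(v))=\rho(\alpha(x))\rho(y)(v)-\rho(\alpha(y))\rho(x)(v)$. Write $\{x,v\}:=\rho(x)(v)$. An $\mathcal{O}$-operator on $(\mathfrak{g},[\cdot,\cdot],\alpha)$ with respect to $(V,\beta,\rho)$ is a linear map $T:V\to\mathfrak{g}$ with $T\circ\beta=\alpha\circ T$ and $[Tu,Tv]=T(\{Tu,v\}-\{Tv,u\})$ for all $u,v\in V$. A hom-pre-Lie algebra $(V,\cdot,\beta)$ is a vector space $V$ with a bilinear map $\cdot:V\otimes V\to V$ and a linear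 map $\beta:V\to V$ such that $\beta(u\cdot v)=\beta(u)\cdot\beta(v)$ and $(u\cdot v)\cdot\beta(w)-\beta(u)\cdot(v\cdot w)=(v\cdot u)\cdot\beta(w)-\beta(v)\cdot(u\cdot w)$ for all $u,v,w\in V$. *)

(* Defs.v *)
From mathcomp Require Export all_boot all_order all_algebra.

Set Implicit Arguments.
Unset Strict Implicit.
Unset Printing Implicit Defensive.

Import GRing.Theory.
Local Open Scope ring_scope.

Record is_hom_Lie (k : fieldType) (g : lmodType k)
    (br : {bilinear g -> g -> g}) (alpha : {linear g -> g}) : Prop := HomLie {
  hom_Lie_skew : forall x y, br x y = - br y x;
  hom_Lie_mult : forall x y, alpha (br x y) = br (alpha x) (alpha y);
  hom_Lie_jacobi : forall x y z,
    br (alpha x) (br y z) + br (alpha y) (br z x) + br (alpha z) (br x y) = 0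
}.

(* [{linear V -> V}] plays the role of End(V); it carries no vector space
   structure in the library, so linearity of [rho] into End(V) is expressed
   pointwise in [v]. *)
Record is_representation (k : fieldType) (g : lmodType k)
    (br : {bilinear g -> g -> g}) (alpha : {linear g -> g})
    (V : lmodType k) (beta : {linear V -> V}) (rho : g -> {linear V -> V})
    : Prop := Representation {
  rep_linear : forall v, linear (fun x => rho x v);
  rep_twist : forall x v, rho (alpha x) (beta v) = beta (rho x v);
  rep_bracket : forall x y v,
    rho (br x y) (beta v) = rho (alpha x) (rho y v) - rho (alpha y) (rho x v)
}.

Record is_O_operator (k : fieldType) (g : lmodType k)
    (br : {bilinear g -> g -> g}) (alpha : {linear g -> g})
    (V : lmodType k) (beta : {linear V -> V}) (rho : g -> {linear V -> V})
    (T : {linear V -> g}) : Prop := OOperator {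
  O_operator_comm : forall v, T (beta v) = alpha (T v);
  O_operator_bracket : forall u v,
    br (T u) (T v) = T (rho (T u) v - rho (T v) u)
}.

(* Unlike the bracket of a hom-Lie algebra, the product is a bare function whose
   bilinearity is part of the predicate, so that it has to be established when
   a product is defined by a formula. *)
Record is_hom_preLie (k : fieldType) (V : lmodType k)
    (mul : V -> V -> V) (beta : {linear V -> V}) : Prop := HomPreLie {
  hom_preLie_bilinear : bilinear_for *:%R *:%R mul;
  hom_preLie_mult : forall u v, beta (mul u v) = mul (beta u) (beta v);
  hom_preLie_assoc : forall u v w,
    mul (mul u v) (beta w) - mul (beta u) (mul v w)
    = mul (mul v u) (beta w) - mul (beta v) (mul u w)
}.

Definition O_mul (k : fieldType) (g V : lmodType k)
    (rho : g -> {linear V -> V}) (T : {linear V -> g}) (v w : V) : V :=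
  rho (T v) w.

(* Main.v *)
Require Import Defs.

Import GRing.Theory.
Local Open Scope ring_scope.

(** Take the bracket axiom of [rho] at [T u], [T v]. Since [[Tu,Tv] = T(u.v - v.u)] and
    [alpha T = T beta], it reads [(u.v).beta w - (v.u).beta w = beta u.(v.w) - beta v.(u.w)], which
    is the hom-pre-Lie identity with its terms regrouped. *)

Theorem proposition3p11 (k : fieldType) (char_k : [pchar k] =i pred0)
    (g : lmodType k) (br : {bilinear g -> g -> g}) (alpha : {linear g -> g})
    (hg : is_hom_Lie br alpha)
    (V : lmodType k) (beta : {linear V -> V}) (rho : g -> {linear V -> V})
    (hV : is_representation br alpha beta rho)
    (T : {linear V -> g}) (hT : is_O_operator br alpha beta rho T) :
  is_hom_preLie (O_mul rho T) beta.
Proof.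
case: hV => rho_lin rho_twist rho_br; case: hT => T_comm T_br.
have rhoB x y v : rho (x - y) v = rho x v - rho y v.
  (* [rho_lin] speaks of [a *: x + y], so the difference is written as [-1 *: y + x]. *)
  by rewrite addrC -scaleN1r rho_lin scaleN1r addrC.
split=> [|u v|u v w]; rewrite /O_mul.
- split=> [w|v] c x y /=; last exact: linearP.
  by rewrite linearP rho_lin.
- by rewrite T_comm rho_twist.
- have := rho_br (T u) (T v) w.
  rewrite T_br linearB rhoB -!T_comm => /eqP.
  (* Solve for [(u.v).beta w] and substitute; the terms [beta u.(v.w)] cancel. *)
  by rewrite subr_eq => /eqP ->; rewrite [LHS]addrC addrA addKr addrC.
Qed.
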